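(* Suppose $(U,S)$ is an action pair in a monoid $M$ (with identity $1$) such that: $U$ is a submonoid of $M$; $U\setminus\{1\}$ is a subsemigroup of $U$, and $U\setminus\{1\}\subseteq US$; and $(U,S^1)$ is an action pair in $M$ extending $(U,S)$. Use the notation of the context, and let $\Phi:(X_U\cup X_S)^+\to US$ be the morphism determined by $x\mapsto x\phi_U$ for $x\in X_U$ and $x\mapsto x\phi_S$ for $x\in X_S$. (i) If there exists a subset $V\subseteq U\setminus\{1\}$ such that $$\Theta_u=\bigvee_{v\in V,\ v\preceq u}\Theta_v\qquad\text{for all }u\in U\setminus\{1\},$$ then $US$ has presentation $\operatorname{Sgp}\langle X_U\cup X_S:R_U\cup R_S\cup R_1\cup R_2'\cup R_3\rangle$ via $\Phi$, where $$R_2'=\{(N_U(v)N_S(s),\,N_U(v)N_S(t)):v\in V,\ (s,t)\in\Omega_v\}.$$ (ii) If $U$ is commutative, and if $\Theta_{uv}=\Theta_u\vee\Theta_v$ for all $u,v\in U$, then $US$ has presentation $\operatorname{Sgp}\langle X_U\cup X_S:R_U\cup R_S\cup R_1\cup R_2''\cup R_3\rangle$ via $\Phi$, where $$R_2''=\{(xN_S(s),\,xN_S(t)):x\in X_U,\ (s,t)\in\Omega_{\overline x}\}.$$ Here $$R_1=\{(xy,\,{}^xy\cdot x):x\in X_S,\ y\in X_U\},\qquad R_3=\{(x,\,x^+x):x\in X_S,\ \overline x^+\neq1\},$$ with ${}^xy=N_U({}^{\overline x}\,\overline y)\in X_U^*$ and $x^+=N_U(\overline x^+)\in X_U^*$ for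 $x\in X_S$, $y\in X_U$.
   Context: Action pairs. For a subsemigroup $U$ of a monoid $M$ with identity $1$, $U^1=U\cup\{1\}$. An action pair in $M$ is a pair $(U,S)$ of subsemigroups of $M$ with a left action $(s,u)\mapsto{}^su$ of $S$ on $U^1$ by semigroup morphisms (${}^s({}^tu)={}^{st}u$ and ${}^s(uv)={}^su\cdot{}^sv$) such that (A1) $s\cdot u={}^su\cdot s$ for all $s\in S$, $u\in U^1$, and (A2) $us=vt\Rightarrow u\cdot{}^s1=v\cdot{}^t1$ for all $u,v\in U^1$, $s,t\in S$. Write $s^+={}^s1$. $US=\{us:u\in U,s\in S\}$. ''$(U,S^1)$ is an action pair extending $(U,S)$'' means that $(U,S^1)$ is an action pair in $M$ with the map $S\to U^1:s\mapsto s^+$ being the restriction of the corresponding map $S^1\to U^1$ (equivalently, the action of $S$ is the restriction of that of $S^1$). Right congruences. For $u\in U$, $\Theta_u=\{(s,t)\in S^1\times S^1:us=ut\}$ is a right congruence on $S^1$; for each $u\in U\setminus\{1\}$, $\Omega_u\subseteq S^1\times S^1$ is a fixed set of pairs generating $\Theta_u$ as a right congruence on $S^1$. For $u,v\in U$, $v\preceq u$ means $u=wv$ for some $w\in U^1$. Joins are taken in the lattice of all equivalence relations on $S^1$. Presentations. $X^+$ is the free semigroup of non-empty words over $X$, and $X^*=X^+\cup\{\iota\}$ with $\iota$ the empty word; for $R\subseteq X^+\times X^+$, $R^\sharp$ is the congruence on $X^+$ generated by $R$. A semigroup $T$ has presentation $\operatorname{Sgp}\langle X:R\rangle$ via $\phi$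 if $\phi:X^+\to T$ is a surjective morphism with kernel $R^\sharp$. A normal form function is a map $N:T\to X^+$ with $N(t)\phi=t$ for all $t\in T$. Maps are written on the right. Fixed data. $U\setminus\{1\}$ has presentation $\operatorname{Sgp}\langle X_U:R_U\rangle$ via $\phi_U:X_U^+\to U\setminus\{1\}$, and $S$ has presentation $\operatorname{Sgp}\langle X_S:R_S\rangle$ via $\phi_S:X_S^+\to S$, where $X_U\cap X_S=\varnothing$ and $\phi_U|_{X_U}$, $\phi_S|_{X_S}$ are injective. Write $\overline w=w\phi_U$ for $w\in X_U^+$ and $\overline w=w\phi_S$ for $w\in X_S^+$. $N_U:U\setminus\{1\}\to X_U^+$ and $N_S:S\to X_S^+$ are fixed normal form functions with $N_U(\overline x)=x$ for $x\in X_U$ and $N_S(\overline y)=y$ for $y\in X_S$. By convention $N_U(1)=\iota$; if $1\notin S$ then also $N_S(1)=\iota$ (if $1\in S$, $N_S(1)$ is the given non-empty word mapping to $1$).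
   Formalization: The formal theorem adds the hypothesis that if 1 ∈ S then U = {1}; when 1 ∈ S and U ≠ {1} the claim is false, since no relation identifies N_U(u) with N_U(u)N_S(1) (e.g. U = {1,e}, e² = e, S = {1}). *)

(* Defs.v *)
From mathcomp Require Import all_boot.
From mathcomp Require Import boolp classical_sets.

Set Implicit Arguments.
Unset Strict Implicit.
Unset Printing Implicit Defensive.


Local Open Scope group_scope.
Local Open Scope classical_set_scope.

(* Binary relations on T are sets of pairs; an equivalence on a subset A of T
   is required to be contained in A x A. *)
Definition equivalence_on (T : Type) (A : set T) (E : set (T * T)) : Prop :=
  [/\ E `<=` A `*` A,
      forall x, A x -> E (x, x),
      forall x y, E (x, y) -> E (y, x) &
      forall x y z, E (x, y) -> E (y, z) -> E (x, z)].

(* The join, in the lattice of equivalences on A, of a family of equivalences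
   with union E; for an empty family this is the equality relation on A. *)
Definition join_on (T : Type) (A : set T) (E : set (T * T)) : set (T * T) :=
  smallest (equivalence_on A) E.

Section ActionPairs.
Variable M : monoidType.
Implicit Types (U S A T V : set M) (act : M -> M -> M).

Definition subsemigroup U : Prop := forall x y, U x -> U y -> U (x * y).

Definition submonoid U : Prop := U 1 /\ subsemigroup U.

Definition adjoin1 U : set M := U `|` [set 1].

Definition setmul U S : set M := [set u * s | u in U & s in S].

(* The values of [act s u] matter only for s in S and u in U^1. *)
Record action_pair U S act : Prop := ActionPair {
  action_pairUl : subsemigroup U;
  action_pairSr : subsemigroup S;
  action_pair_stable : forall s u, S s -> adjoin1 U u -> adjoin1 U (act s u);
  action_pair_act : forall s t u, S s -> S t -> adjoin1 U u ->
    act s (act t u) = act (s * t) u;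
  action_pair_morph : forall s u v, S s -> adjoin1 U u -> adjoin1 U v ->
    act s (u * v) = act s u * act s v;
  action_pair_A1 : forall s u, S s -> adjoin1 U u -> s * u = act s u * s;
  action_pair_A2 : forall u v s t, adjoin1 U u -> adjoin1 U v -> S s -> S t ->
    u * s = v * t -> u * act s 1 = v * act t 1 }.

Definition extends_to_adjoin1 U S act act1 : Prop :=
  action_pair U (adjoin1 S) act1 /\ (forall s, S s -> act1 s 1 = act s 1).

Definition right_congruence A (E : set (M * M)) : Prop :=
  equivalence_on A E /\
  (forall s t a, E (s, t) -> A a -> E (s * a, t * a)).

Definition right_congruence_gen A (O : set (M * M)) : set (M * M) :=
  smallest (right_congruence A) O.

Definition Theta S (u : M) : set (M * M) :=
  [set p | [/\ adjoin1 S p.1, adjoin1 S p.2 & u * p.1 = u * p.2]].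

Definition preceq U (v u : M) : Prop := exists2 w, adjoin1 U w & u = w * v.

End ActionPairs.

(* Elements of X^+ are the non-empty sequences over X, with concatenation. *)
Definition words1 (X : Type) : set (seq X) := [set w | w <> [::]].
Arguments words1 : clear implicits.

Definition word_congruence (X : Type) (E : set (seq X * seq X)) : Prop :=
  equivalence_on (words1 X) E /\
  (forall u v w, E (u, v) -> words1 X w ->
     E (w ++ u, w ++ v) /\ E (u ++ w, v ++ w)).

Definition word_congruence_gen (X : Type) (R : set (seq X * seq X)) :
  set (seq X * seq X) := smallest (@word_congruence X) R.

Section Presentations.
Variable M : monoidType.

(* Morphisms X^+ -> T into a subsemigroup T of M are maps [seq X -> M] whose
   value at the empty sequence is irrelevant. *)
Definition word_morphism (X : Type) (phi : seq X -> M) : Prop :=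
  forall u v, words1 X u -> words1 X v -> phi (u ++ v) = phi u * phi v.

Definition word_kernel (X : Type) (phi : seq X -> M) : set (seq X * seq X) :=
  [set p | [/\ words1 X p.1, words1 X p.2 & phi p.1 = phi p.2]].

Definition has_presentation (X : Type) (T : set M) (R : set (seq X * seq X))
    (phi : seq X -> M) : Prop :=
  [/\ R `<=` words1 X `*` words1 X,
      word_morphism phi,
      phi @` words1 X = T &
      word_kernel phi = word_congruence_gen R].

Definition letters_injective (X : Type) (phi : seq X -> M) : Prop :=
  injective (fun x => phi [:: x]).

Definition normal_form (X : Type) (T : set M) (phi : seq X -> M)
    (N : M -> seq X) : Prop :=
  forall t, T t -> words1 X (N t) /\ phi (N t) = t.

(* The disjoint union of the alphabets XU and XS is the sum type XU + XS. *)
Variables XU XS : Type.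

Definition wordU (w : seq XU) : seq (XU + XS) := map inl w.
Definition wordS (w : seq XS) : seq (XU + XS) := map inr w.

Definition liftU (R : set (seq XU * seq XU)) :
    set (seq (XU + XS) * seq (XU + XS)) :=
  [set (wordU p.1, wordU p.2) | p in R].
Definition liftS (R : set (seq XS * seq XS)) :
    set (seq (XU + XS) * seq (XU + XS)) :=
  [set (wordS p.1, wordS p.2) | p in R].

Variables (act : M -> M -> M) (phiU : seq XU -> M) (phiS : seq XS -> M).
Variables (NU : M -> seq XU) (NS : M -> seq XS).

Definition Phi (w : seq (XU + XS)) : M :=
  \big[mul/1]_(z <- w)
    match z with inl x => phiU [:: x] | inr y => phiS [:: y] end.

Definition R1 : set (seq (XU + XS) * seq (XU + XS)) :=
  [set p | exists (x : XS) (y : XU),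
     p = ([:: inr x; inl y],
          wordU (NU (act (phiS [:: x]) (phiU [:: y]))) ++ [:: inr x])].

Definition R2' (V : set M) (Omega : M -> set (M * M)) :
    set (seq (XU + XS) * seq (XU + XS)) :=
  [set p | exists v s t, [/\ V v, Omega v (s, t) &
     p = (wordU (NU v) ++ wordS (NS s), wordU (NU v) ++ wordS (NS t))]].

Definition R2'' (Omega : M -> set (M * M)) :
    set (seq (XU + XS) * seq (XU + XS)) :=
  [set p | exists x s t, Omega (phiU [:: x]) (s, t) /\
     p = (inl x :: wordS (NS s), inl x :: wordS (NS t))].

Definition R3 : set (seq (XU + XS) * seq (XU + XS)) :=
  [set p | exists x : XS, act (phiS [:: x]) 1 <> 1 /\
     p = ([:: inr x], wordU (NU (act (phiS [:: x]) 1)) ++ [:: inr x])].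

End Presentations.

(* Main.v *)
Require Import Defs.
From mathcomp Require Import all_boot.
From mathcomp Require Import boolp classical_sets.
Local Open Scope group_scope.
Local Open Scope classical_set_scope.

(** Why the theorem is true.

    The relations hold in US: [R1] is (A1), [R3] is (A1) at the identity
    ([s = s * 1 = s^+ * s]), and [R2'] holds because [Omega v] lies in
    [Theta v].  The point is that they suffice.

    Reading [R1] and [R3] as rewriting rules, a letter of [XS] can be pushed to
    the right through any word over [XU] ([letter_push]).  Hence every word is
    equivalent to some [N_U(u) N_S(s)] with [u] in U and [s] in S^1
    ([normal_form_complete]), and [N_U(u) N_S(s)] is equivalent to
    [N_U(u s^+) N_S(s)] ([nfw_absorb]).

    If two such words [N_U(u) N_S(s)] and [N_U(v) N_S(t)] have the same value
    [us = vt], then by (A2) for the pair (U, S^1) the elements [u s^+] and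
    [v t^+] are one and the same [e], so both words are equivalent to words
    with first factor [N_U(e)], and [e s = us = vt = e t], that is,
    [(s, t)] is in [Theta e].  If [e = 1] then [u = v = 1], as U without [1] is
    closed under products, and [s = t].  Otherwise it remains to see that
    [N_U(e) N_S(s)] and [N_U(e) N_S(t)] are equivalent ([nfw_Theta]).
    For [e] in V the pairs [(s, t)] with this property form a right congruence
    on S^1 which contains [Omega e] by [R2'], hence contains [Theta e].  If
    [v] is below [e], say [e = wv], multiplying by [N_U(w)] on the left
    transports the property from [v] to [e]; so the pairs which have the
    property for [e] form an equivalence containing all [Theta v] with
    [v] in V below [e], hence their join [Theta e].

    Part (ii) is the special case of part (i) in which V consists of the values
    of the letters of [XU]: writing [e] as a product of letters, the hypothesis
    on products splits [Theta e] as the join of the [Theta] of these letters,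
    and commutativity puts each of them below [e]. *)

(** * Congruences on words *)

Section WordCongruences.
Set Implicit Arguments.
Unset Strict Implicit.

Lemma words1_catl (X : Type) (u v : seq X) : words1 X u -> words1 X (u ++ v).
Proof. by case: u. Qed.

Lemma words1_catr (X : Type) (u v : seq X) : words1 X v -> words1 X (u ++ v).
Proof. by case: u. Qed.

Lemma words1_map (X Y : Type) (f : X -> Y) (u : seq X) :
  words1 X u -> words1 Y (map f u).
Proof. by case: u. Qed.

(** The hypothesis guarantees that [R] lies in at least one congruence, namely
    the full one, so that the intersection defining the generated congruence
    consists of pairs of non-empty words. *)
Lemma word_congruence_genP (X : Type) (R : set (seq X * seq X)) :
  R `<=` words1 X `*` words1 X -> word_congruence (word_congruence_gen R).
Proof.
move=> Rw; split; first split.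
- apply: smallest_sub Rw; split; first split=> //.
  + by move=> x y [].
  + by move=> x y z [/= ? _] [].
  + by move=> u v w [/= u1 v1] w1; split; split;
      solve [exact: words1_catl | exact: words1_catr].
- by move=> x x1 E [[[_ Er _ _] _] _]; apply: Er.
- move=> x y xy E EP; have [[_ _ Es _] _] := EP.1.
  by apply: Es; apply: xy.
- move=> x y z xy yz E EP; have [[_ _ _ Et] _] := EP.1.
  by apply: Et (yz _ EP); apply: xy.
- by move=> u v w uv w1; split=> E EP; have [_ Ec] := EP.1;
    have [? ?] := Ec _ _ _ (uv _ EP) w1.
Qed.

Lemma word_congruence_gen_map (X Y : Type) (f : X -> Y)
    (R : set (seq X * seq X)) (R' : set (seq Y * seq Y)) u v :
    R `<=` words1 X `*` words1 X -> R' `<=` words1 Y `*` words1 Y ->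
    (forall p, R p -> R' (map f p.1, map f p.2)) ->
  word_congruence_gen R (u, v) -> word_congruence_gen R' (map f u, map f v).
Proof.
move=> Rw /word_congruence_genP[[_ Er Es Et] Ec] RR'.
pose E : set (seq X * seq X) :=
  [set p | [/\ words1 X p.1, words1 X p.2 &
               word_congruence_gen R' (map f p.1, map f p.2)]].
suff EP : word_congruence_gen R `<=` E by move=> /EP[].
apply: smallest_sub=> [|p Rp]; last first.
  by have [? ?] := Rw p Rp; split=> //; apply: sub_gen_smallest; apply: RR'.
split; first split.
- by move=> p [].
- by move=> x x1; split=> //=; apply: Er; apply: words1_map.
- by move=> x y [/= *]; split=> //=; apply: Es.
- by move=> x y z [/= ? ? xy] [/= ? ? yz]; split=> //=; apply: Et xy yz.
- move=> a b w [/= a1 b1 ab] w1.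
  have [] := Ec _ _ _ ab (words1_map (f := f) w1).
  by rewrite -!map_cat => *; split; split=> //=;
    solve [exact: words1_catl | exact: words1_catr].
Qed.

(** Normal forms may have an empty factor, so calculations take place in the
    free monoid: the congruence generated by [R] is extended to it by making
    the empty word equivalent to itself only. *)
Definition word_eqv (X : Type) (R : set (seq X * seq X)) (u v : seq X) : Prop :=
  u = v \/ word_congruence_gen R (u, v).

Section Equivalence.
Variables (X : Type) (R : set (seq X * seq X)).
Hypothesis Rw : R `<=` words1 X `*` words1 X.

Lemma word_eqv_refl u : word_eqv R u u. Proof. by left. Qed.

Lemma word_eqv_sym u v : word_eqv R u v -> word_eqv R v u.
Proof.
case=> [->|uv]; [exact: word_eqv_refl | right].
by have [[_ _ Es _] _] := word_congruence_genP Rw; apply: Es.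
Qed.

Lemma word_eqv_trans v u w : word_eqv R u v -> word_eqv R v w -> word_eqv R u w.
Proof.
case=> [->//|uv] [<-|vw]; right=> //.
by have [[_ _ _ Et] _] := word_congruence_genP Rw; apply: Et uv vw.
Qed.

Lemma word_eqv_cat2l w u v : word_eqv R u v -> word_eqv R (w ++ u) (w ++ v).
Proof.
case: w => [//|x w] [->|uv]; [exact: word_eqv_refl | right].
have [_ Ec] := word_congruence_genP Rw.
by have [] := Ec _ _ (x :: w) uv.
Qed.

Lemma word_eqv_cat2r w u v : word_eqv R u v -> word_eqv R (u ++ w) (v ++ w).
Proof.
case: w => [|x w]; first by rewrite !cats0.
case=> [->|uv]; [exact: word_eqv_refl | right].
have [_ Ec] := word_congruence_genP Rw.
by have [] := Ec _ _ (x :: w) uv.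
Qed.

Lemma word_eqv_rel u v : R (u, v) -> word_eqv R u v.
Proof. by move=> Ruv; right; apply: sub_gen_smallest. Qed.

Lemma word_eqv_gen u v :
  words1 X u -> word_eqv R u v -> word_congruence_gen R (u, v).
Proof.
have [[_ Er _ _] _] := word_congruence_genP Rw.
by move=> u1 [<-|//]; apply: Er.
Qed.

End Equivalence.

Lemma word_kernel_congruence (M : monoidType) (X : Type) (phi : seq X -> M) :
  word_morphism phi -> word_congruence (word_kernel phi).
Proof.
move=> phiM; split; first split.
- by move=> p [].
- by [].
- by move=> x y [].
- by move=> x y z [/= ? ? xy] [/= ? ? yz]; split=> //=; rewrite xy.
- move=> u v w [/= u1 v1 uv] w1.
  by split; split=> /=; rewrite ?phiM ?uv //;
    solve [exact: words1_catl | exact: words1_catr].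
Qed.

Lemma word_morphism_big (M : monoidType) (X : Type) (phi : seq X -> M) w :
    word_morphism phi -> words1 X w ->
  \big[mul/1]_(x <- w) phi [:: x] = phi w.
Proof.
move=> phiM; elim: w => [//|x [|y w] IH _]; first by rewrite big_seq1.
by rewrite big_cons IH // -phiM.
Qed.

End WordCongruences.

(** * Normal forms and completeness of the relations *)

Section Completeness.
Set Implicit Arguments.
Unset Strict Implicit.
Variables (M : monoidType) (U S : set M) (act act1 : M -> M -> M).
Variables (XU XS : Type).
Variables (RU : set (seq XU * seq XU)) (RS : set (seq XS * seq XS)).
Variables (phiU : seq XU -> M) (phiS : seq XS -> M).
Variables (NU : M -> seq XU) (NS : M -> seq XS).
Variables (Omega : M -> set (M * M)) (V : set M).
Hypotheses (hUS : action_pair U S act) (hU : submonoid U).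
Hypotheses (hU' : subsemigroup (U `\ 1)) (hU'US : U `\ 1 `<=` setmul U S).
Hypothesis hext : extends_to_adjoin1 U S act act1.
Hypothesis hS1 : S 1 -> U = [set 1].
Hypotheses (hpU : has_presentation (U `\ 1) RU phiU).
Hypotheses (hpS : has_presentation S RS phiS).
Hypotheses (hNU : normal_form (U `\ 1) phiU NU) (hNS : normal_form S phiS NS).
Hypotheses (hNU1 : NU 1 = [::]) (hNS1 : ~ S 1 -> NS 1 = [::]).
Hypothesis hOmega : forall u, (U `\ 1) u ->
  Omega u `<=` adjoin1 S `*` adjoin1 S /\
  right_congruence_gen (adjoin1 S) (Omega u) = Theta S u.
Hypothesis hV : V `<=` U `\ 1.
Hypothesis hTheta : forall u, (U `\ 1) u ->
  Theta S u = join_on (adjoin1 S)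
    (\bigcup_(v in [set v | V v /\ preceq U v u]) Theta S v).

Local Notation relations := (liftU RU `|` liftS RS `|` R1 act phiU phiS NU
  `|` R2' NU NS V Omega `|` R3 act phiS NU).
Local Notation wU := (@wordU XU XS).
Local Notation wS := (@wordS XU XS).
Local Notation value := (Phi phiU phiS).
Local Notation "u ~~ v" := (word_eqv relations u v) (at level 70).

Let U1 : U 1. Proof. by case: hU. Qed.
Let UM u v : U u -> U v -> U (u * v). Proof. by case: hU => _; apply. Qed.
Let SM s t : S s -> S t -> S (s * t).
Proof. exact: (action_pairSr hUS). Qed.

Lemma adjoin1U u : adjoin1 U u -> U u.
Proof. by case=> // ->. Qed.

Lemma act_in s u : S s -> U u -> U (act s u).
Proof.
by move=> Ss Uu; apply/adjoin1U/(action_pair_stable hUS) => //; left.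
Qed.

(** Disposes of the case [e = 1] in [nfw_inj], which the
    hypotheses on [Omega] and [Theta] leave aside. *)
Lemma mul_eq1 u v : U u -> U v -> u * v = 1 -> u = 1 /\ v = 1.
Proof.
move=> Uu Uv uv; case: (pselect (u = 1)) => [u1|u1].
  by rewrite u1 mul1g in uv.
case: (pselect (v = 1)) => [v1|v1]; first by rewrite v1 mulg1 in uv.
by have [] := hU' (conj Uu u1) (conj Uv v1).
Qed.

Lemma adjoin1M s t : adjoin1 S s -> adjoin1 S t -> adjoin1 S (s * t).
Proof.
move=> [Ss|->] [St|->]; rewrite ?mulg1 ?mul1g.
- by left; apply: SM.
- by left.
- by left.
- by right.
Qed.

Lemma value_cat w w' : value (w ++ w') = value w * value w'.
Proof. exact: big_cat. Qed.

Lemma value_nil : value [::] = 1.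
Proof. exact: big_nil. Qed.

Lemma value_wordU p : words1 XU p -> value (wU p) = phiU p.
Proof.
by case: hpU => _ phiM _ _ p1; rewrite /Phi big_map word_morphism_big.
Qed.

Lemma value_wordS q : words1 XS q -> value (wS q) = phiS q.
Proof.
by case: hpS => _ phiM _ _ q1; rewrite /Phi big_map word_morphism_big.
Qed.

Lemma phiU_in p : words1 XU p -> (U `\ 1) (phiU p).
Proof. by case: hpU => _ _ <- _ p1; exists p. Qed.

Lemma phiS_in q : words1 XS q -> S (phiS q).
Proof. by case: hpS => _ _ <- _ q1; exists q. Qed.

Lemma value_wordU_in p : U (value (wU p)).
Proof.
case: p => [|x p]; first by rewrite value_nil.
by rewrite value_wordU //; case: (@phiU_in (x :: p)).
Qed.

Lemma value_NU u : U u -> value (wU (NU u)) = u.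
Proof.
move=> Uu; case: (pselect (u = 1)) => [->|u1]; first by rewrite hNU1 value_nil.
by have [? uE] := hNU (conj Uu u1); rewrite value_wordU.
Qed.

Lemma value_NS s : adjoin1 S s -> value (wS (NS s)) = s.
Proof.
move=> S1s; have [Ss|nSs] := pselect (S s).
  by have [? sE] := hNS Ss; rewrite value_wordS.
by case: S1s nSs => [//|->] nS1; rewrite hNS1 // value_nil.
Qed.

Definition nfw u s := wU (NU u) ++ wS (NS s).

Lemma value_nfw u s : U u -> adjoin1 S s -> value (nfw u s) = u * s.
Proof. by move=> Uu S1s; rewrite value_cat value_NU // value_NS. Qed.

Lemma relations_words1 : relations `<=` words1 _ `*` words1 _.
Proof.
have [RUw _ _ _] := hpU; have [RSw _ _ _] := hpS.
move=> p [[[[[q Rq <-]|[q Rq <-]]|[x [y ->]]]|]|[x [_ ->]]].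
- by have [] := RUw q Rq; split; apply: words1_map.
- by have [] := RSw q Rq; split; apply: words1_map.
- by split=> //=; apply: words1_catr.
- move=> [v [s [t [/hV/hNU[v1 _] _ ->]]]].
  by split; apply: words1_catl; apply: words1_map.
- by split=> //=; apply: words1_catr.
Qed.

Lemma Omega_Theta v s t : (U `\ 1) v -> Omega v (s, t) -> Theta S v (s, t).
Proof. by move=> /hOmega[_ <-]; apply: sub_gen_smallest. Qed.

Lemma value_morphism : word_morphism value.
Proof. by move=> u v _ _; apply: value_cat. Qed.

Lemma value_letterS x : value [:: inr x] = phiS [:: x].
Proof. exact: big_seq1. Qed.

Lemma value_letterU x : value [:: inl x] = phiU [:: x].
Proof. exact: big_seq1. Qed.

Lemma letterS_in x : S (phiS [:: x]). Proof. exact: phiS_in. Qed.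

Lemma letterU_in x : U (phiU [:: x]).
Proof. by case: (@phiU_in [:: x]). Qed.

Lemma relations_sound : relations `<=` word_kernel value.
Proof.
move=> p Rp; have [p1 p2] := relations_words1 Rp; split=> // {p1 p2}.
have [RUw _ _ kU] := hpU; have [RSw _ _ kS] := hpS.
case: Rp => [[[[[q Rq <-]|[q Rq <-]]|[x [y ->]]]|]|[x [_ ->]]] /=.
- have : word_kernel phiU q by rewrite kU; apply: sub_gen_smallest.
  by case=> *; rewrite !value_wordU.
- have : word_kernel phiS q by rewrite kS; apply: sub_gen_smallest.
  by case=> *; rewrite !value_wordS.
- rewrite value_cat -[[:: inr x; _]]/([:: inr x] ++ [:: inl y]) value_cat.
  have Sx := letterS_in x; have Uy := letterU_in y.
  rewrite value_letterS value_letterU value_NU; last exact: act_in.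
  by apply: (action_pair_A1 hUS) => //; left.
- move=> [v [s [t [/hV vU Ost ->]]]] /=.
  have [/= S1s S1t vst] := Omega_Theta vU Ost.
  by rewrite !value_nfw //; case: vU.
- have Sx := letterS_in x.
  rewrite value_cat value_letterS value_NU; last exact: act_in.
  by rewrite -(action_pair_A1 hUS) ?mulg1 //; left.
Qed.

Lemma word_eqv_value u v : u ~~ v -> value u = value v.
Proof.
case=> [->//|uv]; suff [] : word_kernel value (u, v) by [].
apply: (smallest_sub _ relations_sound uv).
exact: word_kernel_congruence value_morphism.
Qed.

Let cat2l w u v : u ~~ v -> w ++ u ~~ w ++ v.
Proof. exact/word_eqv_cat2l/relations_words1. Qed.
Let cat2r w u v : u ~~ v -> u ++ w ~~ v ++ w.
Proof. exact/word_eqv_cat2r/relations_words1. Qed.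
Let trans v u w : u ~~ v -> v ~~ w -> u ~~ w.
Proof. exact/word_eqv_trans/relations_words1. Qed.
Let sym u v : u ~~ v -> v ~~ u.
Proof. exact/word_eqv_sym/relations_words1. Qed.

(** The empty word needs no exception: its value [1] is not the value of a
    non-empty word over [XU]. *)
Lemma wordU_eqv p q : value (wU p) = value (wU q) -> wU p ~~ wU q.
Proof.
have [RUw _ _ kU] := hpU.
case: p => [|x p]; case: q => [|y q]; first by left.
- by rewrite value_nil value_wordU // => /esym;
    case: (@phiU_in (y :: q)).
- by rewrite value_nil value_wordU //;
    case: (@phiU_in (x :: p)).
- rewrite !value_wordU // => pq; right.
  apply: (word_congruence_gen_map RUw relations_words1); last first.
    by rewrite -[word_congruence_gen RU]kU.
  by move=> r Rr; do 4!left; exists r.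
Qed.

Lemma wordS_eqv p q :
  words1 XS p -> words1 XS q -> phiS p = phiS q -> wS p ~~ wS q.
Proof.
have [RSw _ _ kS] := hpS => p1 q1 pq; right.
apply: (word_congruence_gen_map RSw relations_words1); last first.
  by rewrite -[word_congruence_gen RS]kS.
by move=> r Rr; do 3!left; right; exists r.
Qed.

Lemma NU_mul u v : U u -> U v -> wU (NU u) ++ wU (NU v) ~~ wU (NU (u * v)).
Proof.
move=> Uu Uv; rewrite -[_ ++ _]map_cat; apply: wordU_eqv.
by rewrite [wU (_ ++ _)]map_cat value_cat !value_NU //; apply: UM.
Qed.

(** If [1] is not in S then [N_S(1)] is empty, and if it is then S^1 = S; either
    way [N_S] is multiplicative on the whole of S^1. *)
Lemma NS_mul s t :
  adjoin1 S s -> adjoin1 S t -> wS (NS s) ++ wS (NS t) ~~ wS (NS (s * t)).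
Proof.
have NS1 r : adjoin1 S r -> ~ S r -> r = 1 /\ NS r = [::].
  by move=> [//|->] nS1; rewrite hNS1.
move=> S1s S1t; have [Ss|/(NS1 s S1s)[-> ->]] := pselect (S s); last first.
  by rewrite mul1g; left.
have [St|/(NS1 t S1t)[-> ->]] := pselect (S t); last first.
  by rewrite mulg1 cats0; left.
have [s1 sE] := hNS Ss; have [t1 tE] := hNS St.
have [st1 stE] := hNS (SM Ss St); have [_ phiM _ _] := hpS.
rewrite -[_ ++ _]map_cat; apply: wordS_eqv => //; first exact: words1_catl.
by rewrite phiM // sE tE.
Qed.

(** The rewriting step behind normal forms, by induction on [p]: [R3] handles
    the empty word and [R1] moves [x] past one letter. *)
Lemma letter_push x p :
  inr x :: wU p
    ~~ wU (NU (act (phiS [:: x]) (value (wU p)))) ++ [:: inr x].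
Proof.
have Sx := letterS_in x; elim: p => [|y p IH].
  rewrite value_nil; case: (pselect (act (phiS [:: x]) 1 = 1)) => [->|x1].
    by rewrite hNU1; left.
  by apply: word_eqv_rel; right; exists x.
have Uy := letterU_in y; have Up := value_wordU_in p.
have xy : [:: inr x; inl y]
    ~~ wU (NU (act (phiS [:: x]) (phiU [:: y]))) ++ [:: inr x].
  by apply: word_eqv_rel; do 2!left; right; exists x, y.
apply: trans (cat2r (wU p) xy) _; rewrite -catA.
apply: trans (cat2l _ IH) _; rewrite catA; apply: cat2r.
rewrite -[wU (y :: p)]/([:: inl y] ++ wU p) value_cat value_letterU.
rewrite (action_pair_morph hUS) //; [|by left..].
by apply: NU_mul; apply: act_in.
Qed.

(** The relation [R3] for words: the last letters produce their own prefix,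
    which [letter_push] carries through the first letter, turning it into
    [act x (w^+) = (xw)^+]. *)
Lemma wordS_plus w :
  words1 XS w -> wS w ~~ wU (NU (act (phiS w) 1)) ++ wS w.
Proof.
have [_ phiM _ _] := hpS.
elim: w => [//|x [|y w] IH _].
  by have := letter_push x [::]; rewrite value_nil.
have Sx := letterS_in x; have Sw : S (phiS (y :: w)) by apply: phiS_in.
apply: trans (cat2l [:: inr x] (IH _)) _ => //; rewrite catA.
apply: trans (cat2r _ (letter_push x _)) _; rewrite -catA.
rewrite value_NU; last exact: act_in.
rewrite (action_pair_act hUS) //; last by left.
by rewrite -phiM //; left.
Qed.

Lemma adjoin1_plus s : adjoin1 S s -> U (act1 s 1) /\ act1 s 1 * s = s.
Proof.
have [h1 _] := hext => S1s; have U11 : adjoin1 U 1 by left.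
split; first exact/adjoin1U/(action_pair_stable h1).
by rewrite -(action_pair_A1 h1) // mulg1.
Qed.

Lemma nfw_absorb u s :
  U u -> adjoin1 S s -> nfw u s ~~ nfw (u * act1 s 1) s.
Proof.
move=> Uu S1s; have [Ss|nSs] := pselect (S s).
  have [s1 sE] := hNS Ss.
  apply: trans (cat2l _ (wordS_plus s1)) _; rewrite catA sE; apply: cat2r.
  rewrite hext.2 //; apply: NU_mul => //.
  exact: act_in.
have -> : s = 1 by case: S1s.
have [_] : U (act1 1 1) /\ act1 1 1 * 1 = 1 by apply: adjoin1_plus; right.
by rewrite mulg1 => ->; rewrite mulg1; left.
Qed.

Lemma normal_form_complete w : words1 _ w ->
  exists u s, [/\ U u, adjoin1 S s & w ~~ nfw u s].
Proof.
move=> w1.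
have [p [q pq]] : exists p q, w ~~ wU p ++ wS q.
  elim: w {w1} => [|[y|x] w [p [q wpq]]]; first by exists [::], [::]; left.
    by exists (y :: p), q; apply: (cat2l [:: inl y]).
  exists (NU (act (phiS [:: x]) (value (wU p)))), (x :: q).
  apply: trans (cat2l [:: inr x] wpq) _.
  by apply: trans (cat2r (wS q) (letter_push x p)) _; rewrite -catA; left.
have pN : wU p ~~ wU (NU (value (wU p))).
  by apply: wordU_eqv; rewrite value_NU //; apply: value_wordU_in.
have {pN}wN := trans pq (cat2r (wS q) pN).
exists (value (wU p)); case: q pq wN => [|x q] pq wN; last first.
  have q1 : words1 XS (x :: q) by [].
  have Sq := phiS_in q1; have [N1 NE] := hNS Sq.
  exists (phiS (x :: q)); split; [exact: value_wordU_in | by left |].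
  by apply: trans wN _; apply/cat2l/wordS_eqv.
exists 1; split; [exact: value_wordU_in | by right |].
rewrite /nfw hNS1 // => S1.
(* the word has no letter in XS: if 1 were in S then U would be trivial and XU
   empty, so w would be equivalent to the empty word *)
case: p pq {wN} => [|y p] pq; last first.
  by case: (@phiU_in [:: y]) => //; rewrite (hS1 S1).
case: pq => [//|pq].
have [[Ew _ _ _] _] := word_congruence_genP relations_words1.
by case: (Ew _ pq).
Qed.

(** The pairs for which completeness is visible over the fixed first factor
    [N_U(u)].  Recording them as a subset of S^1 x S^1 makes this a right
    congruence there, comparable with [Theta S u] and with joins. *)
Definition nfw_eqv u : set (M * M) :=
  [set p | [/\ adjoin1 S p.1, adjoin1 S p.2 & nfw u p.1 ~~ nfw u p.2]].

Lemma nfw_eqv_equivalence u : equivalence_on (adjoin1 S) (nfw_eqv u).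
Proof.
split.
- by move=> p [].
- by move=> s Ss; split=> //; left.
- by move=> s t [/= *]; split=> //; apply: sym.
- by move=> r s t [/= ? ? rs] [/= ? ? st]; split=> //; apply: trans rs st.
Qed.

Lemma nfw_eqv_right_congruence u : right_congruence (adjoin1 S) (nfw_eqv u).
Proof.
split=> [|s t a [/= S1s S1t st] S1a]; first exact: nfw_eqv_equivalence.
split; [exact: adjoin1M | exact: adjoin1M |].
have nfwM r : adjoin1 S r -> nfw u r ++ wS (NS a) ~~ nfw u (r * a).
  by move=> S1r; rewrite -catA; apply/cat2l/NS_mul.
by apply: trans (sym (nfwM s S1s)) _; apply: trans (cat2r _ st) _; apply: nfwM.
Qed.

Lemma nfw_eqv_mull w v s t : U w -> U v ->
  nfw_eqv v (s, t) -> nfw_eqv (w * v) (s, t).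
Proof.
move=> Uw Uv [/= S1s S1t st]; split=> //=.
have nfwM r : nfw (w * v) r ~~ wU (NU w) ++ nfw v r.
  by rewrite catA; apply/cat2r/sym/NU_mul.
by apply: trans (nfwM s) _; apply: trans (cat2l _ st) _; apply/sym/nfwM.
Qed.

(** [Theta v] is a least right congruence and [Theta u] a least equivalence, so
    it is enough that [nfw_eqv] is one and contains the generators: [Omega v]
    for [v] in V by [R2'], then [Theta v] for [v] in V below [u] by
    [nfw_eqv_mull]. *)
Lemma nfw_Theta u : (U `\ 1) u -> Theta S u `<=` nfw_eqv u.
Proof.
move=> uU; rewrite hTheta //; apply: smallest_sub.
  exact: nfw_eqv_equivalence.
move=> [s t] [v [Vv [w /adjoin1U Uw ->]]] vst.
have vU := hV Vv; apply: nfw_eqv_mull => //; first by case: vU.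
have [Ow OE] := hOmega vU; move: vst; rewrite -OE.
apply: smallest_sub=> [|[{}s {}t] Ost]; first exact: nfw_eqv_right_congruence.
have [S1s S1t] := Ow _ Ost; split=> //=.
by apply: word_eqv_rel; left; right; exists v, s, t.
Qed.

(** Both words are rewritten over the common first factor supplied by (A2) for
    (U, S^1), so that only [nfw_Theta] is left to use. *)
Lemma nfw_inj u v s t : U u -> U v -> adjoin1 S s -> adjoin1 S t ->
  u * s = v * t -> nfw u s ~~ nfw v t.
Proof.
move=> Uu Uv S1s S1t E; have [h1 _] := hext.
have A2 : u * act1 s 1 = v * act1 t 1.
  by apply: (action_pair_A2 h1) => //; left.
have [Us sE] := adjoin1_plus S1s; have [Ut tE] := adjoin1_plus S1t.
have [e1|e1] := pselect (u * act1 s 1 = 1).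
  have [u1 _] := mul_eq1 Uu Us e1.
  have [v1 _] := mul_eq1 Uv Ut (etrans (esym A2) e1).
  by move: E; rewrite u1 v1 !mul1g => ->; left.
apply: trans (nfw_absorb Uu S1s) _.
apply: trans (sym (nfw_absorb Uv S1t)); rewrite -A2.
suff [] : nfw_eqv (u * act1 s 1) (s, t) by [].
apply: nfw_Theta; first by split=> //; apply: UM.
by split=> //=; rewrite {2}A2 -!mulgA sE tE.
Qed.

Lemma value_in w : words1 _ w -> setmul U S (value w).
Proof.
have USM a b : setmul U S a -> setmul U S b -> setmul U S (a * b).
  move=> [u Uu [s Ss <-]] [v Uv [t St <-]].
  exists (u * act s v); first by apply: UM => //; apply: act_in.
  exists (s * t); first exact: SM.
  have sv : s * v = act s v * s by apply: (action_pair_A1 hUS) => //; left.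
  by rewrite -!mulgA; congr (_ * _); rewrite !mulgA sv.
have letter z : setmul U S (value [:: z]).
  case: z => [y|x]; first by rewrite value_letterU; apply/hU'US/phiU_in.
  exists 1 => //; exists (phiS [:: x]); first exact: letterS_in.
  by rewrite mul1g value_letterS.
elim: w => [//|z [|z' w] IH _] //.
by rewrite -cat1s value_cat; apply: USM => //; apply: IH.
Qed.

Lemma value_surj m : setmul U S m -> (value @` words1 _) m.
Proof.
move=> [u Uu [s Ss <-]]; exists (nfw u s).
  by have [s1 _] := hNS Ss; apply/words1_catr/words1_map.
by rewrite value_nfw //; left.
Qed.

Lemma presentation_of_Theta_joins :
  has_presentation (setmul U S) relations value.
Proof.
split.
- exact: relations_words1.
- exact: value_morphism.
- by apply/seteqP; split=> [m [w w1 <-]|m];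
    [apply: value_in | apply: value_surj].
apply/seteqP; split; last first.
  apply: smallest_sub relations_sound.
  exact: word_kernel_congruence value_morphism.
move=> [w w'] [/= w1 w'1 ww'].
have [u [s [Uu S1s wE]]] := normal_form_complete w1.
have [v [t [Uv S1t w'E]]] := normal_form_complete w'1.
apply: (word_eqv_gen relations_words1 w1).
apply: (trans wE); apply: trans (sym w'E); apply: nfw_inj => //.
by rewrite -!value_nfw // -(word_eqv_value wE) -(word_eqv_value w'E).
Qed.

End Completeness.

(** * The commutative case *)

Section Letters.
Set Implicit Arguments.
Unset Strict Implicit.
Variables (M : monoidType) (U S : set M) (XU : Type) (phiU : seq XU -> M).
Variable RU : set (seq XU * seq XU).

Lemma Theta_preceq v u : preceq U v u -> Theta S v `<=` Theta S u.
Proof.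
by move=> [w _ ->] [s t] [/= ? ? vst]; split=> //=; rewrite -!mulgA vst.
Qed.

Lemma Theta_equivalence u : equivalence_on (adjoin1 S) (Theta S u).
Proof.
split.
- by move=> p [].
- by [].
- by move=> s t [].
- by move=> r s t [/= ? ? rs] [/= ? ? st]; split=> //=; rewrite rs.
Qed.

Hypothesis hpU : has_presentation (U `\ 1) RU phiU.
Hypothesis UM : subsemigroup U.
Hypothesis UC : forall u v, U u -> U v -> u * v = v * u.
Hypothesis ThetaM : forall u v, U u -> U v ->
  Theta S (u * v) = join_on (adjoin1 S) (Theta S u `|` Theta S v).

(** Induction on a word representing [u]: [ThetaM] splits off the first letter,
    and the words that arise are suffixes of the given one, whose values are
    below [u] in the order [preceq].  The converse inclusion is
    [Theta_preceq]. *)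
Lemma Theta_letters u : (U `\ 1) u ->
  Theta S u = join_on (adjoin1 S)
    (\bigcup_(v in [set v | range (fun x => phiU [:: x]) v /\ preceq U v u])
       Theta S v).
Proof.
have [_ phiM phiUE _] := hpU.
have Uphi p : words1 XU p -> U (phiU p).
  by move=> p1; have [] : (U `\ 1) (phiU p) by rewrite -phiUE; exists p.
move=> uU; apply/seteqP; split=> [st ust E [EP EV]|]; last first.
  apply: smallest_sub; first exact: Theta_equivalence.
  by move=> st [v [_ vu]]; apply: Theta_preceq.
suff ind p : words1 XU p -> preceq U (phiU p) u -> Theta S (phiU p) `<=` E.
  move: uU ust; rewrite -phiUE => -[p p1 pu]; rewrite -pu; apply: ind => //.
  by exists 1; [right | rewrite mul1g].
elim: p => [//|x [|y p] IH _ pu].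
  by move=> a ax; apply: EV; exists (phiU [:: x]) => //; split=> //; exists x.
have x1 : U (phiU [:: x]) by apply: Uphi.
have p1 : U (phiU (y :: p)) by apply: Uphi.
have xp : phiU (x :: y :: p) = phiU [:: x] * phiU (y :: p) by rewrite -phiM.
rewrite xp in pu *; rewrite ThetaM //; apply: smallest_sub => //.
have [w w1 uE] := pu.
have wM v : U v -> adjoin1 U (w * v).
  by move=> Uv; left; case: w1 => [Uw|->]; [apply: UM | rewrite mul1g].
move=> a [xa|pa].
  apply: EV; exists (phiU [:: x]) => //; split; first by exists x.
  (* commutativity brings the letter to the right end of [u] *)
  by exists (w * phiU (y :: p)); [exact: wM | rewrite -mulgA (UC p1)].
by apply: IH pa => //; exists (w * phiU [:: x]); [exact: wM | rewrite -mulgA].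
Qed.

End Letters.

Theorem theorem6p44 (M : monoidType) (U S : set M) (act act1 : M -> M -> M)
  (XU XS : Type)
  (RU : set (seq XU * seq XU)) (RS : set (seq XS * seq XS))
  (phiU : seq XU -> M) (phiS : seq XS -> M)
  (NU : M -> seq XU) (NS : M -> seq XS)
  (Omega : M -> set (M * M))
  (hUS : action_pair U S act)
  (hU : submonoid U)
  (hU' : subsemigroup (U `\ 1))
  (hU'US : U `\ 1 `<=` setmul U S)
  (hext : extends_to_adjoin1 U S act act1)
  (* Added hypothesis, vacuous when 1 is not in S: if 1 is in S and U <> {1},
     no listed relation identifies a word over XU with a word containing a
     letter of XS, so both presentations fail. *)
  (hS1 : S 1 -> U = [set 1])
  (hpU : has_presentation (U `\ 1) RU phiU)
  (hpS : has_presentation S RS phiS)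
  (hiU : letters_injective phiU)
  (hiS : letters_injective phiS)
  (hNU : normal_form (U `\ 1) phiU NU)
  (hNS : normal_form S phiS NS)
  (hNUx : forall x, NU (phiU [:: x]) = [:: x])
  (hNSy : forall y, NS (phiS [:: y]) = [:: y])
  (hNU1 : NU 1 = [::])
  (hNS1 : ~ S 1 -> NS 1 = [::])
  (hOmega : forall u, (U `\ 1) u ->
     Omega u `<=` adjoin1 S `*` adjoin1 S /\
     right_congruence_gen (adjoin1 S) (Omega u) = Theta S u) :
  (forall V : set M, V `<=` U `\ 1 ->
     (forall u, (U `\ 1) u ->
        Theta S u = join_on (adjoin1 S)
          (\bigcup_(v in [set v | V v /\ preceq U v u]) Theta S v)) ->
     has_presentation (setmul U S)
       (liftU RU `|` liftS RS `|` R1 act phiU phiS NU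
          `|` R2' NU NS V Omega `|` R3 act phiS NU)
       (Phi phiU phiS))
  /\
  ((forall u v, U u -> U v -> u * v = v * u) ->
     (forall u v, U u -> U v ->
        Theta S (u * v) = join_on (adjoin1 S) (Theta S u `|` Theta S v)) ->
     has_presentation (setmul U S)
       (liftU RU `|` liftS RS `|` R1 act phiU phiS NU
          `|` R2'' phiU NS Omega `|` R3 act phiS NU)
       (Phi phiU phiS)).
Proof.
split=> [V hV hTheta|UC ThetaM].
  exact: (presentation_of_Theta_joins hUS hU hU' hU'US hext hS1 hpU hpS hNU hNS
            hNU1 hNS1 hOmega hV hTheta).
pose V : set M := range (fun x => phiU [:: x]).
have hV : V `<=` U `\ 1.
  by have [_ _ <- _] := hpU => v [x _ <-]; exists [:: x].
have -> : @R2'' M XU XS phiU NS Omega = R2' NU NS V Omega.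
  apply/seteqP; split=> p.
    move=> [x [s [t [Ost ->]]]]; exists (phiU [:: x]), s, t.
    by split=> //; [exists x | rewrite hNUx].
  move=> [v [s [t [[x _ <-] Ost ->]]]]; exists x, s, t; split=> //.
  by rewrite hNUx.
apply: (presentation_of_Theta_joins hUS hU hU' hU'US hext hS1 hpU hpS hNU hNS
          hNU1 hNS1 hOmega hV).
exact: (Theta_letters hpU (proj2 hU) UC ThetaM).
Qed.
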